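(* Let $H$ be a complex Hilbert space and let $T\in B(H)$ be subnormal. Then $T$ is orbit reflexive.
   Context: $B(H)$ is the set of all bounded linear operators on $H$. An operator on $H$ is subnormal if it is the restriction of a normal operator on some Hilbert space containing $H$ to the invariant subspace $H$. Define $Orb(T)=\{T^n:n\ge 0\}$ (with $T^0=1$) and $Orb(T,x)=\{T^nx:n\ge 0\}$. $\mathrm{OrbRef}(T)$ is the set of all $A\in B(H)$ such that, for every vector $x$, $Ax$ is in the norm closure of $Orb(T,x)$. $T$ is orbit reflexive if $\mathrm{OrbRef}(T)$ is the closure of $Orb(T)$ in the strong operator topology. *)

(* Defs.v *)
(* The complex field is [R[i]], for [R : realType]. *)
From HB Require Import structures.
From mathcomp Require Import all_boot all_order all_algebra.
From mathcomp Require Import complex.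
From mathcomp Require Import boolp classical_sets reals topology normedtype.

Set Implicit Arguments.
Unset Strict Implicit.
Unset Printing Implicit Defensive.

Import Order.TTheory GRing.Theory Num.Theory.

Local Open Scope classical_set_scope.
Local Open Scope ring_scope.

(* The inner product is linear in its first argument and conjugate-linear in
   the second one. *)
HB.mixin Record NormedModule_isHilbert (R : realType) H
    & CompleteNormedModule R[i] H := {
  inner : {dot H for (@Num.conj R[i])} ;
  inner_norm : forall x : H, inner x x = `|x| ^+ 2
}.

#[short(type="hilbertType")]
HB.structure Definition Hilbert (R : realType) :=
  {H of CompleteNormedModule R[i] H & NormedModule_isHilbert R H}.

HB.mixin Record isBoundedOp (K : numFieldType) (V W : normedModType K)
    (f : V -> W) := {
  bounded_op : exists2 M : K, 0 <= M & forall x, `|f x| <= M * `|x|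
}.

HB.structure Definition BoundedOp (K : numFieldType) (V W : normedModType K) :=
  {f of @GRing.Linear K V W *:%R f & isBoundedOp K V W f}.

Notation "{ 'bounded_op' V -> W }" := (BoundedOp.type V%type W%type)
  (at level 0, V at level 98, W at level 99,
   format "{ 'bounded_op'  V  ->  W }") : type_scope.

HB.instance Definition _ (K : numFieldType) (V W : normedModType K) :=
  gen_eqMixin {bounded_op V -> W}.
HB.instance Definition _ (K : numFieldType) (V W : normedModType K) :=
  gen_choiceMixin {bounded_op V -> W}.

Section Powers.
Variables (K : numFieldType) (V : normedModType K) (T : {bounded_op V -> V}).
Variable n : nat.

Lemma iter_op_linear : linear (iter n T).
Proof. by elim: n => [|m IHm] a x y //=; rewrite IHm linearP. Qed.

Lemma iter_op_bounded :
  exists2 M : K, 0 <= M & forall x, `|iter n T x| <= M * `|x|.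
Proof.
have [M M0 hM] := @bounded_op _ _ _ T.
exists (M ^+ n); first exact: exprn_ge0.
elim: n => [|m IHm] x /=; first by rewrite expr0 mul1r.
by rewrite (le_trans (hM _))// exprS -mulrA ler_wpM2l.
Qed.

HB.instance Definition _ :=
  GRing.isLinear.Build K V V *:%R (iter n T) iter_op_linear.
HB.instance Definition _ :=
  isBoundedOp.Build K V V (iter n T) iter_op_bounded.

Definition opow : {bounded_op V -> V} := iter n T.

End Powers.

(* The operators equipped with the strong operator topology, i.e. the topology
   induced by pointwise convergence in the norm of [W]. *)
Definition sot (K : numFieldType) (V W : normedModType K) : Type :=
  initial_topology (fun f : {bounded_op V -> W} => (f : {ptws V -> W})).

HB.instance Definition _ (K : numFieldType) (V W : normedModType K) :=
  Topological.copy (sot V W)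
    (initial_topology (fun f : {bounded_op V -> W} => (f : {ptws V -> W}))).

Section Orbits.
Variables (R : realType) (H : hilbertType R).
Implicit Types (T : {bounded_op H -> H}) (x : H).

Definition Orb T : set {bounded_op H -> H} := range (opow T).

Definition Orb_at T x : set H := range (fun n => opow T n x).

Definition OrbRef T : set {bounded_op H -> H} :=
  [set A : {bounded_op H -> H} | forall x, closure (Orb_at T x) (A x)].

Definition orbit_reflexive T : Prop :=
  OrbRef T = closure (Orb T : set (sot H H)).

End Orbits.

Section Subnormal.
Variable R : realType.

Definition is_adjoint (H : hilbertType R) (A B : {bounded_op H -> H}) : Prop :=
  forall x y : H, inner (A x) y = inner x (B y).

Definition normal_op (H : hilbertType R) (N : {bounded_op H -> H}) : Prop :=
  exists2 Nadj : {bounded_op H -> H},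
    is_adjoint N Nadj & forall x, N (Nadj x) = Nadj (N x).

(* [J] identifies [H] with a closed subspace of [K], which is [N]-invariant and
   on which [N] restricts to [T]. *)
Definition subnormal (H : hilbertType R) (T : {bounded_op H -> H}) : Prop :=
  exists (K : hilbertType R) (J : {linear H -> K}) (N : {bounded_op K -> K}),
    [/\ forall x y, inner (J x) (J y) = inner x y,
        normal_op N &
        forall x, N (J x) = J (T x)].

End Subnormal.

(* Main.v *)
Require Import Defs.
From mathcomp Require Import all_boot all_order all_algebra.
From mathcomp Require Import complex ring lra.
From mathcomp Require Import boolp classical_sets reals topology normedtype.

(** Let [A] be such that [A x] lies in the closure of the orbit of [x] for every
[x].  The proof has two halves.

Reduction to contractions.  The vectors on which [A] agrees with a fixed power
[T^n] form a closed subspace.  If one of these subspaces is everything, [A] is a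
power of [T].  Otherwise Baire's theorem makes the set of vectors [x] with
[A x] outside the orbit of [x] dense ([dense_off_orbit]), and on such vectors
[A x] is approached by powers [T^n x] with [n] arbitrarily large.  In
particular these [T^n x] stay bounded.  Subnormality enters only through
[|T x|^2 <= |T^2 x| |x|] ([subnormal_paranormal]): the sequence [|T^n x|] is
convex, so it is unbounded as soon as [|T x| > |x|].  Hence [|T x| <= |x|] on a
dense set, thus everywhere: [T] is a contraction, and then by density every
[A x] is a limit of [T^n x] along arbitrarily large [n].

Contractions.  Now [|A x| = lim |T^n x|], so [q x = |A x|] is a seminorm for
which both [T] and [A] are isometric.  Complex polarization shows that [A] and
[T] commute up to vectors of seminorm zero ([target_commutes]).  Moreover
[|T^n x - A x|^2] and [q(T^n x - A x)^2] differ by [|T^n x|^2 - |A x|^2], which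
tends to zero ([nrm_iter_sub_target]); so it is enough to make the gap
[q(T^n x - A x)] small for finitely many vectors at once.  The heart of the
matter is to find one vector [x] whose gap controls the gaps of two given
vectors [x1] and [x2] ([gap_dominating_pair]).  If [T] were unitary one would
split [x2] into a part in the reducing subspace generated by [x1] and a part
[y] orthogonal to it, and take [x = x1 + y]: the squares of the gaps of [x1] and
[y] add up.  Here [T] need not be invertible and the projection need not exist
in [H], so [y] is replaced by a near minimizer [T^s x2 - z] of the distance,
where [z] runs over vectors whose gap is controlled by that of [x1]; the shift
by [T^s] does not change any gap, and near minimality gives near orthogonality
of the two orbits. *)

Set Implicit Arguments.
Unset Strict Implicit.
Unset Printing Implicit Defensive.

Import Order.TTheory GRing.Theory Num.Theory.

Local Open Scope classical_set_scope.
Local Open Scope ring_scope.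

(** * The real Hilbert space structure *)

Section RealParts.
Variables (R : realType) (H : hilbertType R).
Implicit Types (x y z : H) (t : R).

(** Inequalities are handled in the totally ordered field [R] rather than in
[R[i]]: the norm is real-valued, and the real part of the inner product makes
[H] a real inner product space with the same norm. *)
Definition nrm x : R := complex.Re `|x|.
Definition rdot x y : R := complex.Re (inner x y).

Lemma nrmE x : `|x| = (nrm x)%:C%C.
Proof. by rewrite /nrm RRe_real ?normr_real. Qed.

Lemma nrm_ge0 x : 0 <= nrm x.
Proof. by rewrite -lecR -nrmE normr_ge0. Qed.

Lemma nrm0 : nrm 0 = 0. Proof. by rewrite /nrm normr0. Qed.

Lemma nrm0_eq0 x : nrm x = 0 -> x = 0.
Proof. by move=> x0; apply/normr0_eq0; rewrite nrmE x0. Qed.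

Lemma nrmN x : nrm (- x) = nrm x.
Proof. by rewrite /nrm normrN. Qed.

Lemma nrmBC x y : nrm (x - y) = nrm (y - x).
Proof. by rewrite -nrmN opprB. Qed.

Lemma nrmD x y : nrm (x + y) <= nrm x + nrm y.
Proof. by rewrite -lecR rmorphD/= -!nrmE ler_normD. Qed.

Lemma nrmB x y : nrm (x - y) <= nrm x + nrm y.
Proof. by rewrite -(nrmN y) nrmD. Qed.

Lemma nrmZi x : nrm ('i%C *: x) = nrm x.
Proof.
by rewrite /nrm normrZ normc_def/= expr0n expr1n add0r sqrtr1 mul1r.
Qed.

Lemma rdotDl x y z : rdot (x + y) z = rdot x z + rdot y z.
Proof. by rewrite /rdot linearDl raddfD. Qed.

Lemma rdotC x y : rdot x y = rdot y x.
Proof. by rewrite /rdot hermC/= expr0 mul1r; case: (inner y x). Qed.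

Lemma rdotDr x y z : rdot x (y + z) = rdot x y + rdot x z.
Proof. by rewrite rdotC rdotDl !(rdotC x). Qed.

Lemma rdotNl x y : rdot (- x) y = - rdot x y.
Proof. by rewrite /rdot linearNl raddfN. Qed.

Lemma rdot0r x : rdot x 0 = 0.
Proof. by rewrite rdotC /rdot linear0l. Qed.

Lemma rdotNr x y : rdot x (- y) = - rdot x y.
Proof. by rewrite rdotC rdotNl rdotC. Qed.

Lemma rdotZl t x y : rdot (t%:C%C *: x) y = t * rdot x y.
Proof.
rewrite /rdot linearZl_LR/=.
by case: (inner x y) => a b /=; rewrite mul0r subr0.
Qed.

Lemma rdotZr t x y : rdot x (t%:C%C *: y) = t * rdot x y.
Proof. by rewrite rdotC rdotZl rdotC. Qed.

Lemma rdotxx x : rdot x x = nrm x ^+ 2.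
Proof. by rewrite /rdot inner_norm nrmE -rmorphXn. Qed.

Lemma nrmZ t x : nrm (t%:C%C *: x) = `|t| * nrm x.
Proof.
rewrite /nrm normrZ normc_def/= expr0n addr0 sqrtr_sqr.
by case: (`|x|) => a b /=; rewrite mul0r subr0.
Qed.

Lemma nrmD_sqr x y :
  nrm (x + y) ^+ 2 = nrm x ^+ 2 + 2 * rdot x y + nrm y ^+ 2.
Proof. by rewrite -!rdotxx !(rdotDl, rdotDr) (rdotC y); ring. Qed.

Lemma rdotZi x y : rdot ('i%C *: x) ('i%C *: y) = rdot x y.
Proof.
have := nrmD_sqr ('i%C *: x) ('i%C *: y).
rewrite -scalerDr !nrmZi nrmD_sqr; lra.
Qed.

Lemma nrmB_sqr x y :
  nrm (x - y) ^+ 2 = nrm x ^+ 2 - 2 * rdot x y + nrm y ^+ 2.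
Proof. by rewrite nrmD_sqr rdotNr nrmN; ring. Qed.

Lemma rdot_le x y : `|rdot x y| <= nrm x * nrm y.
Proof.
have h0 := nrm_ge0 x; have k0 := nrm_ge0 y.
have : 0 <= nrm ((nrm y ^+ 2)%:C%C *: x - (rdot x y)%:C%C *: y) ^+ 2.
  exact: sqr_ge0.
rewrite nrmB_sqr !nrmZ rdotZl rdotZr.
rewrite (ger0_norm (sqr_ge0 _)) => h.
have {}h : 0 <= nrm y ^+ 2 * (nrm x ^+ 2 * nrm y ^+ 2 - rdot x y ^+ 2).
  rewrite [X in _ + X]exprMn real_normK ?num_real// in h.
  apply: le_trans h _; rewrite le_eqVlt; apply/orP; left; apply/eqP; ring.
have [y0|yN0] := eqVneq (nrm y) 0.
  have -> : y = 0 by exact: nrm0_eq0.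
  by rewrite rdot0r normr0 nrm0 mulr0.
rewrite pmulr_rge0 in h; last by rewrite exprn_gt0// lt_neqAle eq_sym yN0.
rewrite -(ler_pXn2r (n:=2)) ?nnegrE ?mulr_ge0//.
by rewrite real_normK ?num_real// exprMn -subr_ge0.
Qed.

End RealParts.

Section RealOperators.
Variables (R : realType) (H : hilbertType R).
Implicit Types (x y z : H) (t : R) (f g : {bounded_op H -> H}).

Lemma nrm_bounded f : exists2 M : R, 0 <= M & forall x, nrm (f x) <= M * nrm x.
Proof.
have [M M0 hM] := @bounded_op _ _ _ f.
have ME : M = (complex.Re M)%:C%C by rewrite RRe_real// ger0_real.
exists (complex.Re M); first by rewrite -lecR -ME.
by move=> x; rewrite -lecR rmorphM/= -ME -!nrmE.
Qed.

Lemma rdot_eq_of_nrm (f g : {linear H -> H}) :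
  (forall x, nrm (f x) = nrm (g x)) ->
  forall x y, rdot (f x) (f y) = rdot (g x) (g y).
Proof.
move=> fg x y; have := fg (x + y); rewrite !linearD => fgxy.
have := nrmD_sqr (f x) (f y); rewrite fgxy nrmD_sqr !fg; lra.
Qed.

(** For a contraction [f], the form [<y, z> - <f y, f z>] is positive
semidefinite, so a vector of zero length for it is orthogonal to everything. *)
Lemma rdot_isometric_at f z : (forall x, nrm (f x) <= nrm x) ->
  nrm (f z) = nrm z -> forall y, rdot (f y) (f z) = rdot y z.
Proof.
move=> f1 fz y; apply/eqP; rewrite -subr_eq0; apply: contraT => D0.
set D := rdot (f y) (f z) - rdot y z in D0 *.
have h t : 2 * t * D <= nrm y ^+ 2 - nrm (f y) ^+ 2.
  have := f1 (y + t%:C%C *: z).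
  rewrite -(ler_pXn2r (n:=2)) ?nnegrE ?nrm_ge0// linearD linearZ/=.
  by rewrite !nrmD_sqr !rdotZr !nrmZ fz /D; nra.
(* An affine function of [t] bounded above has zero slope; this [t] would
   exceed the bound by one. *)
have := h ((nrm y ^+ 2 - nrm (f y) ^+ 2 + 1) / (2 * D)).
rewrite [X in X <= _](_ : _ = nrm y ^+ 2 - nrm (f y) ^+ 2 + 1); last by field.
lra.
Qed.

Lemma iter_opD f n x y : iter n f (x + y) = iter n f x + iter n f y.
Proof. exact: (linearD (opow f n)). Qed.

Lemma iter_opB f n x y : iter n f (x - y) = iter n f x - iter n f y.
Proof. exact: (linearB (opow f n)). Qed.

Lemma iter_opZ f n (c : R[i]) x : iter n f (c *: x) = c *: iter n f x.
Proof. exact: (linearZ_LR (opow f n)). Qed.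

End RealOperators.

Lemma eq0_of_le_eps (R : realFieldType) (a K : R) : 0 <= K ->
  (forall e, 0 < e -> `|a| <= K * e) -> a = 0.
Proof.
move=> K0 h; apply/eqP; apply: contraT => a0.
have a1 : 0 < `|a| by rewrite normr_gt0.
have K1 : 0 < 2 * (K + 1) by lra.
have := h (`|a| / (2 * (K + 1))) (divr_gt0 a1 K1).
rewrite mulrA ler_pdivlMr//; nra.
Qed.

(** * Recurrent limits of a contraction *)

Section Contraction.
Variables (R : realType) (H : hilbertType R) (T A : {bounded_op H -> H}).
(* Throughout this section [A] is a recurrent limit of [T]: pointwise, along
   arbitrarily large powers that may depend on the vector. *)
Implicit Types (x y z : H).
Hypothesis T_contr : forall x, nrm (T x) <= nrm x.
Hypothesis T_rec : forall x (e : R) N, 0 < e ->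
  exists2 n, (N <= n)%N & nrm (iter n T x - A x) < e.

Lemma nrm_iter_le x m n : (m <= n)%N -> nrm (iter n T x) <= nrm (iter m T x).
Proof.
elim: n => [|n IH]; first by rewrite leqn0 => /eqP->.
rewrite leq_eqVlt => /predU1P[->//|]; rewrite ltnS => /IH h.
exact: le_trans (T_contr _) h.
Qed.

Lemma nrm_target_le_iter n x : nrm (A x) <= nrm (iter n T x).
Proof.
apply/ler_addgt0Pr => e e0; have [m nm hm] := T_rec x n e0.
have := nrm_iter_le x nm; have := nrmD (A x - iter m T x) (iter m T x).
rewrite subrK nrmBC; lra.
Qed.

Lemma nrm_iter_le_target x (e : R) : 0 < e ->
  exists N, forall n, (N <= n)%N -> nrm (iter n T x) <= nrm (A x) + e.
Proof.
move=> e0; have [m _ hm] := T_rec x 0 e0; exists m => n mn.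
have := nrm_iter_le x mn; have := nrmD (iter m T x - A x) (A x).
rewrite subrK; lra.
Qed.

Lemma target_contr x : nrm (A x) <= nrm x.
Proof. exact: (nrm_target_le_iter 0). Qed.

Lemma nrm_targetT x : nrm (A (T x)) = nrm (A x).
Proof.
apply/eqP; rewrite eq_le; apply/andP; split.
  apply/ler_addgt0Pr => e /(nrm_iter_le_target x)[N hN].
  apply: le_trans (nrm_target_le_iter N _) _.
  by rewrite -iterSr hN.
apply/ler_addgt0Pr => e /(nrm_iter_le_target (T x))[N hN].
apply: le_trans (hN _ (leqnn _)); rewrite -iterSr; exact: nrm_target_le_iter.
Qed.

Lemma nrm_target_iter n x : nrm (A (iter n T x)) = nrm (A x).
Proof. by elim: n => //= n IH; rewrite nrm_targetT. Qed.

Lemma nrm_targetA x : nrm (A (A x)) = nrm (A x).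
Proof.
apply/eqP; rewrite eq_le target_contr/=; apply/ler_addgt0Pr => e e0.
have [n _ hn] := T_rec x 0 e0.
have := nrmD (A (iter n T x - A x)) (A (A x)).
rewrite -linearD subrK nrm_target_iter.
have := target_contr (iter n T x - A x); lra.
Qed.

Lemma rdot_targetT x y : rdot (A (T x)) (A (T y)) = rdot (A x) (A y).
Proof.
exact: (@rdot_eq_of_nrm _ _ (A \o T) A nrm_targetT).
Qed.

Lemma rdot_target_iter n x y :
  rdot (A (iter n T x)) (A (iter n T y)) = rdot (A x) (A y).
Proof. by elim: n => //= n IH; rewrite rdot_targetT. Qed.

(** [A] is a contraction that is isometric on its own range. *)
Lemma rdot_targetA x y : rdot (A x) (A (A y)) = rdot x (A y).
Proof. exact: (rdot_isometric_at target_contr (nrm_targetA y)). Qed.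

(** In the form [<A x, A y>], which [T] and [A] preserve, replacing [A y] by a
nearby [T^n y] turns [<c T A y, A y>] into [<c T y, y>], and [A]-invariance
does the same to [<c A T y, A y>].  The scalar [c] lets one recover the real
and the imaginary part of the complex form from the real one. *)
Lemma rdot_commutator (c : R[i]) y : (forall x, nrm (c *: x) = nrm x) ->
  rdot (A (c *: (T (A y) - A (T y)))) (A (A y)) = 0.
Proof.
move=> c1; rewrite scalerBr linearB/= rdotDl rdotNl.
rewrite -[c *: A (T y)]linearZ/= [X in _ - X]rdot_targetA.
apply: (@eq0_of_le_eps _ _ (2 * nrm y)) => [|e e0].
  by rewrite mulr_ge0// nrm_ge0.
have [n _ hn] := T_rec y 0 e0; set u := iter n T y in hn *.
rewrite -(rdot_target_iter n (c *: T y) y) -/u iter_opZ -iterSr iterS -/u.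
rewrite [X in `|X|](_ : _ = rdot (A (c *: T (A y - u))) (A (A y)) +
                            rdot (A (c *: T u)) (A (A y - u))); last first.
  by rewrite !(linearB, scalerBr)/= !(rdotDl, rdotDr, rdotNl, rdotNr); ring.
rewrite (le_trans (ler_normD _ _))// -mulrA mulr_natl mulr2n; apply: lerD.
  rewrite (le_trans (rdot_le _ _))// [leRHS]mulrC ler_pM ?nrm_ge0//.
    rewrite (le_trans (target_contr _))// c1 (le_trans (T_contr _))//.
    by rewrite nrmBC ltW.
  by rewrite nrm_targetA target_contr.
rewrite (le_trans (rdot_le _ _))// ler_pM ?nrm_ge0//.
  rewrite (le_trans (target_contr _))// c1 (le_trans (T_contr _))//.
  exact: (nrm_iter_le y (leq0n n)).
by rewrite (le_trans (target_contr _))// nrmBC ltW.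
Qed.

(** A complex sesquilinear form vanishing on the diagonal vanishes; the real
analogue fails: a reflection of the plane is a pointwise recurrent limit of an
irrational rotation that it does not commute with. *)
Lemma target_commutes x : A (T (A x)) = A (A (T x)).
Proof.
have [C CE] : exists C : H -> H, forall u, C u = T (A u) - A (T u).
  by exists (fun u => T (A u) - A (T u)).
pose f (c : R[i]) x y := rdot (A (c *: C x)) (A (A y)).
have CD u v : C (u + v) = C u + C v.
  by rewrite !CE !(linearD A, linearD T) opprD addrACA.
have CZ (c : R[i]) u : C (c *: u) = c *: C u.
  by rewrite !CE scalerBr !linearZ_LR.
have f_antisym c : (forall x, nrm (c *: x) = nrm x) ->
    forall u v, f c u v = - f c v u.
  move=> c1 u v; apply/eqP; rewrite -addr_eq0; apply/eqP.
  have fxx w : f c w w = 0 by rewrite /f CE; exact: rdot_commutator.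
  have := fxx (u + v); have := fxx u; have := fxx v.
  rewrite /f CD scalerDr !(linearD A) !(rdotDl, rdotDr); lra.
have nrm1 u : nrm ((1 : R[i]) *: u) = nrm u by rewrite scale1r.
have fiZ u v : f 1 ('i%C *: u) ('i%C *: v) = f 1 u v.
  by rewrite /f !scale1r CZ !linearZ_LR/= rdotZi.
have fi1 u v : f 'i%C u v = f 1 ('i%C *: u) v by rewrite /f scale1r CZ.
(* Both [f 1] and [f 'i] are antisymmetric, while sesquilinearity turns the
   antisymmetry of [f 1] into symmetry of [f 'i]. *)
have fi_sym u v : f 'i%C u v = f 'i%C v u.
  rewrite !fi1 f_antisym// -fiZ scalerA -expr2 sqr_i scaleN1r.
  by rewrite /f !(linearN A) rdotNr opprK.
have fi0 u v : f 'i%C u v = 0.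
  have := f_antisym _ (@nrmZi _ H) u v; rewrite fi_sym; lra.
have f10 u v : f 1 u v = 0.
  have <- : 'i%C *: (- 'i%C *: u) = u.
    by rewrite scalerA mulrN -expr2 sqr_i opprK scale1r.
  by rewrite -fi1 fi0.
apply/eqP; rewrite -subr_eq0; apply/eqP/nrm0_eq0/eqP; rewrite -sqrf_eq0.
have := f10 x (T x); rewrite /f scale1r CE linearB/= rdotDl rdotNl rdotxx.
by rewrite nrmB_sqr !(nrm_targetA, nrm_targetT) => /eqP h; apply/eqP; lra.
Qed.

(** The distance from [T^n x] to [A x] in the seminorm [|A _|], for which [T]
and [A] are isometric. *)
Definition gap n x : R := nrm (A (iter n T x - A x)).

Lemma gapD n x y : gap n (x + y) <= gap n x + gap n y.
Proof.
by rewrite /gap iter_opD [A (x + y)]linearD/= opprD addrACA linearD nrmD.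
Qed.

Lemma gapZ n (t : R) x : gap n (t%:C%C *: x) = `|t| * gap n x.
Proof.
rewrite /gap iter_opZ [A (_ *: x)]linearZ_LR/= -scalerBr.
by rewrite (linearZ_LR A) nrmZ.
Qed.

(** This invariance stands in for invertibility: a vector may be replaced by any
of its iterates without losing information on its gaps. *)
Lemma gap_iter s n x : gap n (iter s T x) = gap n x.
Proof.
elim: s => //= s <-; set y := iter s T x.
rewrite /gap -iterSr iterS linearB/= -target_commutes.
by rewrite -(linearB A) -(linearB T) nrm_targetT.
Qed.

Lemma gap_le n x : gap n x <= 2 * nrm (A x).
Proof.
rewrite /gap linearB/= (le_trans (nrmB _ _))// nrm_target_iter nrm_targetA.
lra.
Qed.

Lemma gap_le_nrm n x : gap n x <= nrm (iter n T x - A x).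
Proof. exact: target_contr. Qed.

(** [A y] is a limit of points of the orbit of [y]. *)
Lemma rdot_target_le_orbit (c : R) x y :
  (forall j, `|rdot (A x) (A (iter j T y))| <= c) ->
  `|rdot (A x) (A (A y))| <= c.
Proof.
move=> h; apply/ler_addgt0Pr => e e0.
have x1 : 0 < nrm x + 1 by rewrite ltr_wpDl// nrm_ge0.
have [j _ hj] := T_rec y 0 (divr_gt0 e0 x1).
rewrite -[A y](subrK (iter j T y)) linearD/= rdotDr addrC.
rewrite (le_trans (ler_normD _ _))// lerD// (le_trans (rdot_le _ _))//.
have := target_contr x; have := target_contr (A y - iter j T y).
have := nrm_ge0 (A x); have := nrm_ge0 (A (A y - iter j T y)).
rewrite ltr_pdivlMr// nrmBC in hj.
have := nrm_ge0 (A y - iter j T y).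
move: (nrm (A x)) (nrm x) x1 (nrm (A (A y - iter j T y)))
  (nrm (A y - iter j T y)) hj => a b b1 c' d hj d0 c0 a0 cd ab; nra.
Qed.

(** The cross term of [|u + v|^2], for [u] and [v] the vectors measured by the
gaps of [x] and [y], expands into four inner products between closures of the
two orbits. *)
Lemma gap_cross (c : R) x y :
  (forall i j, `|rdot (A (iter i T x)) (A (iter j T y))| <= c) ->
  forall n, `|gap n (x + y) ^+ 2 - gap n x ^+ 2 - gap n y ^+ 2| <= 8 * c.
Proof.
move=> h n.
have h1 i : `|rdot (A (iter i T x)) (A (A y))| <= c.
  exact: rdot_target_le_orbit.
have h2 j : `|rdot (A (A x)) (A (iter j T y))| <= c.
  by rewrite rdotC; apply: rdot_target_le_orbit => i; rewrite rdotC.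
have h3 : `|rdot (A (A x)) (A (A y))| <= c by exact: rdot_target_le_orbit.
have := h n n; have := h1 n; have := h2 n; move: h3.
rewrite /gap iter_opD [A (x + y)]linearD/= opprD addrACA (linearD A) nrmD_sqr.
rewrite !(linearB A) !(rdotDl, rdotDr, rdotNl, rdotNr) !ler_norml; lra.
Qed.

Section TwoVectors.
Variables x1 x2 : H.

(** A shift-invariant real subspace containing the orbit of [x1]; it plays the
role of the cyclic subspace of [x1]. *)
Let S : set H :=
  [set z | exists2 C, 0 <= C & forall n, gap n z <= C * gap n x1].

Let SD y z : S y -> S z -> S (y + z).
Proof.
move=> [C C0 hC] [D D0 hD]; exists (C + D); first exact: addr_ge0.
by move=> n; rewrite (le_trans (gapD _ _ _))// mulrDl lerD.
Qed.

Let SZ (t : R) z : S z -> S (t%:C%C *: z).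
Proof.
move=> [C C0 hC]; exists (`|t| * C); first by rewrite mulr_ge0.
by move=> n; rewrite gapZ -mulrA ler_wpM2l.
Qed.

Let S_iter s z : S z -> S (iter s T z).
Proof. by move=> [C C0 hC]; exists C => // n; rewrite gap_iter. Qed.

Let S1 : S x1.
Proof. by exists 1 => // n; rewrite mul1r. Qed.

(** The iterate of [x2] is allowed to vary, because the infimum over all of them
is the squared distance, for the seminorm [|A _|], from [x2] to the reducing
subspace that [S] would generate if [T] were inverted. *)
Let dists : set R :=
  [set r | exists s z, S z /\ r = nrm (A (iter s T x2 - z)) ^+ 2].

Let dist := inf dists.

Let has_inf_dists : has_inf dists.
Proof.
split; first by exists (nrm (A (iter 0 T x2 - x1)) ^+ 2), 0%N, x1.
by exists 0 => _ [s [z [_ ->]]]; exact: sqr_ge0.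
Qed.

Let dist_le s z : S z -> dist <= nrm (A (iter s T x2 - z)) ^+ 2.
Proof.
move=> Sz; apply: ge_inf; first by case: has_inf_dists.
by exists s, z.
Qed.

Let dist_approx (e : R) : 0 < e ->
  exists s z, S z /\ nrm (A (iter s T x2 - z)) ^+ 2 <= dist + e.
Proof.
move=> e0; have [_ [s [z [Sz ->]]] h] := inf_adherent e0 has_inf_dists.
by exists s, z; split => //; exact: ltW.
Qed.

(** Moving a near minimizer along [T^i x1] cannot shorten it by much: the
infimum does not decrease when the residual is iterated and corrected by
elements of [S]. *)
Let residual_orth (k : R) s z i j : 0 < k -> S z ->
  nrm (A (iter s T x2 - z)) ^+ 2 <= dist + k ^+ 2 ->
  `|rdot (A (iter i T x1)) (A (iter j T (iter s T x2 - z)))|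
    <= k * (1 + nrm (A x1) ^+ 2).
Proof.
move=> k0 Sz hs; set b := rdot _ _.
have h (t : R) : 2 * (t * b) <= k ^+ 2 + t ^+ 2 * nrm (A x1) ^+ 2.
  have := dist_le (j + s) (SD (S_iter j Sz) (SZ t (S_iter i S1))).
  rewrite opprD addrA iterD -iter_opB.
  rewrite linearB/= nrmB_sqr nrm_target_iter linearZ_LR/= rdotZr nrmZ.
  rewrite nrm_target_iter exprMn real_normK ?num_real//.
  rewrite (rdotC _ (A (iter i _ _))).
  rewrite -/b; lra.
(* Optimizing over [t] would give [k * nrm (A x1)]; [t = k] and [t = - k] are
   enough and avoid dividing by [nrm (A x1)]. *)
have := h k; have := h (- k); rewrite sqrrN => h1 h2.
rewrite ler_norml; apply/andP; split; nra.
Qed.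

(** Parallelogram law: the midpoint of two residuals, brought to the same
iterate of [x2], is again a residual. *)
Let residual_close (k : R) s z s' z' : S z -> S z' ->
  nrm (A (iter s T x2 - z)) ^+ 2 <= dist + k ^+ 2 ->
  nrm (A (iter s' T x2 - z')) ^+ 2 <= dist + k ^+ 2 ->
  nrm (A (iter s' T (iter s T x2 - z) - iter s T (iter s' T x2 - z'))) ^+ 2
    <= 4 * k ^+ 2.
Proof.
move=> Sz Sz' h h'.
have := dist_le (s + s') (SZ (2^-1) (SD (S_iter s' Sz) (S_iter s Sz'))).
set u := iter s T x2 - z in h *; set v := iter s' T x2 - z' in h' *.
have -> : iter (s + s') T x2 - (2^-1)%:C%C *: (iter s' T z + iter s T z')
        = (2^-1)%:C%C *: (iter s' T u + iter s T v).
  rewrite /u /v !iter_opB -!iterD (addnC s') addrACA -opprD scalerBr.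
  congr (_ - _).
  rewrite scalerDr -scalerDl -rmorphD/=.
  by rewrite (_ : 2^-1 + 2^-1 = 1 :> R) ?scale1r//; field.
rewrite linearZ_LR/= nrmZ exprMn real_normK ?num_real// (linearD A) (linearB A).
rewrite nrmD_sqr nrmB_sqr !nrm_target_iter; lra.
Qed.

(** Two near minimizers are needed.  The first, [y0], is fixed before the target
accuracy [r] for the gap of [x1], since [r] depends on the constant [C] of its
correction term [z0].  The second, [y], is chosen afterwards, close enough to
the minimum for the orbits of [x1] and [y] to be orthogonal up to order
[r ^+ 2].  The parallelogram law transfers smallness of the gap from [y] to
[y0], and [x2] is [y0 + z0] up to an iterate. *)
Lemma gap_dominating_pair (e : R) : 0 < e ->
  exists x, exists2 d, 0 < d &
    forall n, gap n x < d -> gap n x1 < e /\ gap n x2 < e.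
Proof.
move=> e0; pose k0 := e / 16; have k00 : 0 < k0 by rewrite /k0; lra.
have [s0 [z0 [Sz0 h0]]] := dist_approx (exprn_gt0 2 k00).
have [C C0 hC] := Sz0.
have C1 : 0 < 4 * (C + 1) by lra.
pose r := e / (4 * (C + 1)); have r0 : 0 < r by exact: divr_gt0.
have rE : C * r + r = e / 4 by rewrite /r; field; lra.
pose Q := 1 + nrm (A x1) ^+ 2.
have Q0 : 0 < Q by rewrite /Q ltr_wpDr// sqr_ge0.
pose k := Num.min k0 (r ^+ 2 / (16 * Q)).
have kk0 : k <= k0 by rewrite /k ge_min lexx.
have kQ : 16 * (k * Q) <= r ^+ 2.
  have : k <= r ^+ 2 / (16 * Q) by rewrite /k ge_min lexx orbT.
  by rewrite ler_pdivlMr ?mulr_gt0//; lra.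
have kgt0 : 0 < k.
  rewrite /k lt_min k00/=; apply: divr_gt0; first exact: exprn_gt0.
  by rewrite mulr_gt0// ltr0n.
have [s [z [Sz h]]] := dist_approx (exprn_gt0 2 kgt0).
set y := iter s T x2 - z in h.
exists (x1 + y), (r / 2); first by rewrite divr_gt0.
move=> n hn.
have gap_ge0 w : 0 <= gap n w by exact: nrm_ge0.
have cross := gap_cross (fun i j => residual_orth i j kgt0 Sz h) n.
have sq : gap n x1 ^+ 2 + gap n y ^+ 2 < r ^+ 2.
  move: cross; rewrite -/y -/Q ler_norml => /andP[cross _].
  have := gap_ge0 (x1 + y); nra.
have hx1 : gap n x1 < r by have := gap_ge0 x1; have := gap_ge0 y; nra.
have hy : gap n y < r by have := gap_ge0 x1; have := gap_ge0 y; nra.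
split; first by nra.
set y0 := iter s0 T x2 - z0 in h0.
pose w := iter s T y0 - iter s0 T y.
have hw : gap n w <= 4 * k0.
  apply: le_trans (gap_le n w) _.
  have h' : nrm (A y) ^+ 2 <= dist + k0 ^+ 2 by nra.
  have := residual_close Sz0 Sz h0 h'; rewrite -/y0 -/y -/w => hw.
  have := nrm_ge0 (A w); nra.
have hy0 : gap n y0 <= gap n y + 4 * k0.
  rewrite -(gap_iter s) -[iter s T y0](subrK (iter s0 T y)) -/w.
  by rewrite (le_trans (gapD _ _ _))// gap_iter; lra.
have : gap n x2 <= gap n y0 + gap n z0.
  by rewrite -(gap_iter s0) -[iter s0 T x2](subrK z0) gapD.
have := hC n; have : C * gap n x1 <= C * r by rewrite ler_wpM2l// ltW.
rewrite /k0 in hy0; lra.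
Qed.

End TwoVectors.

Lemma gap_dominating (l : seq H) (e : R) : 0 < e ->
  exists x, exists2 d, 0 < d &
    forall n, gap n x < d -> forall z, z \in l -> gap n z < e.
Proof.
move=> e0; elim: l => [|z l [x [d d0 hx]]]; first by exists 0, 1.
have m0 : 0 < Num.min d e by rewrite lt_min d0.
have [y [d' d'0 hy]] := gap_dominating_pair x z m0.
exists y, d' => // n /hy[]; rewrite !lt_min => /andP[gx _] /andP[_ gz] w.
by rewrite inE => /predU1P[->//|]; exact: hx.
Qed.

(** [<A T^n x, A A x> = <T^n x, A x>], so the two squares have the same cross
term. *)
Lemma nrm_iter_sub_target n x :
  nrm (iter n T x - A x) ^+ 2 =
  gap n x ^+ 2 + (nrm (iter n T x) ^+ 2 - nrm (A x) ^+ 2).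
Proof.
rewrite /gap linearB/= !nrmB_sqr rdot_targetA nrm_target_iter nrm_targetA; ring.
Qed.

Lemma contraction_sot_approx (l : seq H) (e : R) : 0 < e ->
  exists n, forall z, z \in l -> nrm (iter n T z - A z) < e.
Proof.
move=> e0.
have [N hN] : exists N, forall n, (N <= n)%N -> forall z, z \in l ->
    nrm (iter n T z) ^+ 2 <= nrm (A z) ^+ 2 + e ^+ 2 / 2.
  elim: l => [|z l [N hN]]; first by exists 0%N.
  pose a := nrm (A z).
  have a0 : 0 <= a by exact: nrm_ge0.
  (* A [d] with [(a + d) ^+ 2 <= a ^+ 2 + e ^+ 2 / 2], using [d * d <= d * e]. *)
  have d0 : 0 < Num.min e (e ^+ 2 / (2 * (2 * a + e))).
    by rewrite lt_min e0/= divr_gt0 ?exprn_gt0//; lra.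
  have [M hM] := nrm_iter_le_target z d0.
  exists (maxn N M) => n; rewrite geq_max => /andP[Nn Mn] w.
  rewrite inE => /predU1P[->|]; last exact: hN.
  have := hM n Mn; have := nrm_ge0 (iter n T z).
  set d := Num.min _ _ in d0 *.
  have de : d <= e by rewrite /d ge_min lexx.
  have : d <= e ^+ 2 / (2 * (2 * a + e)) by rewrite /d ge_min lexx orbT.
  rewrite ler_pdivlMr; last by lra.
  rewrite -/a => hd b0 hb.
  have : nrm (iter n T z) ^+ 2 <= (a + d) ^+ 2.
    by rewrite lerXn2r ?nnegrE//; lra.
  have : d * d <= d * e by rewrite ler_wpM2l// ltW.
  lra.
have [x [d d0 hx]] := gap_dominating l (divr_gt0 e0 (ltr0n R 2)).
have [n Nn hn] := T_rec x N d0.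
exists n => z zl.
have gz := hx n (le_lt_trans (gap_le_nrm n x) hn) z zl.
have := nrm_iter_sub_target n z; have := hN n Nn z zl.
have := nrm_ge0 (iter n T z - A z).
have : 0 <= gap n z by exact: nrm_ge0.
nra.
Qed.

End Contraction.

(** * Baire category and vectors off their orbit *)

Section Baire.
Variables (R : realType) (H : hilbertType R).
Implicit Types x y z : H.

Lemma nrm_cauchy_cvg (u : nat -> H) (r : nat -> R) :
  (forall e, 0 < e -> exists n, r n < e) ->
  (forall m n, (m <= n)%N -> nrm (u n - u m) <= r m) ->
  exists l, forall n, nrm (l - u n) <= r n.
Proof.
move=> r0 ur.
have ReE (e : R[i]) : 0 < e -> e = (complex.Re e)%:C%C.
  by move=> e0; rewrite RRe_real// gtr0_real.
have : cvg (u @ \oo).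
  apply/cauchy_cvgP/cauchy_exP => e e0.
  have e0' : 0 < complex.Re e by rewrite -ltcR -ReE.
  have [N hN] := r0 _ e0'; exists (u N), N => // n /= Nn.
  rewrite -ball_normE/= nrmE (ReE _ e0) ltcR nrmBC.
  exact: le_lt_trans (ur _ _ Nn) hN.
move=> /cvg_ex[l /cvgrPdist_lt ul]; exists l => n.
apply/ler_addgt0Pr => e e0.
have e0' : 0 < e%:C%C :> R[i] by rewrite ltcR.
have [N _ hN] := ul _ e0'.
have := hN (maxn N n) (leq_maxl _ _); rewrite /= nrmE ltcR => h1.
have h2 := ur n (maxn N n) (leq_maxr _ _).
have := nrmD (l - u (maxn N n)) (u (maxn N n) - u n).
rewrite addrA subrK; lra.
Qed.

(** Baire's theorem.  The hypothesis is what a dense open set provides inside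
each ball; the bound [nrm (y - x) + s <= r] nests the closed balls, whose
centres then converge to a point lying in all of them. *)
Lemma baire_nrm (P : nat -> H -> Prop) :
  (forall n x (r : R), 0 < r -> exists y, exists2 s, 0 < s &
     nrm (y - x) + s <= r /\ forall z, nrm (z - y) <= s -> P n z) ->
  forall x (r : R), 0 < r -> exists2 z, nrm (z - x) <= r & forall n, P n z.
Proof.
move=> hP x r r0.
pose ok (n : nat) (p q : H * R) := 0 < p.2 -> [/\ 0 < q.2, q.2 <= n.+1%:R^-1,
  nrm (q.1 - p.1) + q.2 <= p.2 & forall z, nrm (z - q.1) <= q.2 -> P n z].
have ex_next n p : exists q, ok n p q.
  have [p0|p0] := ltP 0 p.2; last by exists p; rewrite /ok ltNge p0.
  have m0 : 0 < Num.min p.2 n.+1%:R^-1 by rewrite lt_min p0 invr_gt0 ltr0n.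
  have [y [s s0 [ys hs]]] := hP n p.1 _ m0.
  exists (y, s) => _; split => //=.
    apply: le_trans (_ : Num.min p.2 n.+1%:R^-1 <= _); last first.
      by rewrite ge_min lexx orbT.
    have := nrm_ge0 (y - p.1); lra.
  by rewrite (le_trans ys)// ge_min lexx.
pose next n p := sval (cid (ex_next n p)).
have nextP n p : ok n p (next n p) by rewrite /next; case: cid.
pose b := fix b n := if n is m.+1 then next m (b m) else (x, r).
have b0 n : 0 < (b n).2 by elim: n => //= n IH; have [] := nextP n (b n) IH.
have bS n := nextP n (b n) (b0 n).
have nest m k : nrm ((b (m + k)%N).1 - (b m).1) + (b (m + k)%N).2 <= (b m).2.
  elim: k => [|k IH]; first by rewrite addn0 subrr nrm0 add0r.
  rewrite addnS; have [_ _ + _] := bS (m + k)%N.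
  rewrite -/(b (m + k).+1).
  have := nrmD ((b (m + k).+1).1 - (b (m + k)%N).1) ((b (m + k)%N).1 - (b m).1).
  rewrite addrA subrK; lra.
have [||l hl] := @nrm_cauchy_cvg (fun n => (b n).1) (fun n => (b n).2).
- move=> e e0; exists (Num.truncn e^-1).+1 => /=.
  have [_ le1 _ _] := bS (Num.truncn e^-1); apply: le_lt_trans le1 _.
  rewrite -[ltRHS]invrK ltf_pV2 ?posrE ?invr_gt0//.
  exact: Num.Theory.truncnS_gt.
- move=> m n mn /=; have := nest m (n - m)%N; rewrite subnKC//.
  have := b0 n; lra.
exists l; first exact: (hl 0%N).
by move=> n; have [_ _ _] := bS n; apply; exact: (hl n.+1).
Qed.

End Baire.

Section OrbRef.
Variables (R : realType) (H : hilbertType R) (T A : {bounded_op H -> H}).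
Implicit Types x y z : H.

Lemma closure_orbit_approx x : closure (Orb_at T x) (A x) ->
  forall e : R, 0 < e -> exists n, nrm (iter n T x - A x) < e.
Proof.
move=> cl e e0; have e0' : 0 < e%:C%C :> R[i] by rewrite ltcR.
have [_ [[n _ <-]]] := cl _ (nbhsx_ballx (A x) _ e0').
by rewrite -ball_normE/= nrmE ltcR nrmBC => h; exists n.
Qed.

(** Finitely many points of the orbit stay at a positive distance from [A x], so
closer points have a large index. *)
Lemma off_orbit_rec x : closure (Orb_at T x) (A x) ->
  (forall n, A x <> iter n T x) -> forall (e : R) N, 0 < e ->
  exists2 n, (N <= n)%N & nrm (iter n T x - A x) < e.
Proof.
move=> cl off e N e0.
have [d d0 hd] : exists2 d : R, 0 < d &
    forall i, (i < N)%N -> d <= nrm (iter i T x - A x).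
  elim: N => [|N [d d0 hd]]; first by exists 1.
  exists (Num.min d (nrm (iter N T x - A x))).
    rewrite lt_min d0/= lt_neqAle nrm_ge0 andbT eq_sym.
    by apply/eqP => /nrm0_eq0/eqP; rewrite subr_eq0 => /eqP /esym/off.
  move=> i; rewrite ltnS leq_eqVlt => /predU1P[->|/hd h].
    by rewrite ge_min lexx orbT.
  by rewrite ge_min h.
have m0 : 0 < Num.min d e by rewrite lt_min d0.
have [n] := closure_orbit_approx cl m0; rewrite lt_min => /andP[nd ne].
by exists n => //; rewrite leqNgt; apply/negP => /hd; rewrite leNgt nd.
Qed.

(** [A] and [T^n] differ at some vector, and adding a small multiple of it to a
vector where they agree makes them differ; by continuity they still differ
nearby. *)
Lemma dense_off_orbit : (forall n, exists v, A v <> iter n T v) ->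
  forall x (r : R), 0 < r ->
  exists2 z, nrm (z - x) <= r & forall n, A z <> iter n T z.
Proof.
move=> hT; apply: baire_nrm => n x r r0.
have [y ys hy] : exists2 y, nrm (y - x) <= r / 2 & A y <> iter n T y.
  have [hx|hx] := pselect (A x = iter n T x); last first.
    by exists x => //; rewrite subrr nrm0 divr_ge0// ltW.
  have [v hv] := hT n; have v1 : 0 < nrm v + 1 by rewrite ltr_wpDl ?nrm_ge0.
  pose t := r / 2 / (nrm v + 1); have t0 : 0 < t by rewrite !divr_gt0.
  exists (x + t%:C%C *: v).
    rewrite addrC addKr nrmZ gtr0_norm// /t mulrAC ler_pdivrMr//.
    have := nrm_ge0 v; nra.
  rewrite linearD/= iter_opD hx => /addrI; rewrite linearZ_LR/= iter_opZ.
  by move=> /scalerI; apply/contra_not: hv; apply; rewrite eq_complex/= gt_eqF.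
have [M M0 hM] := nrm_bounded A; have [L L0 hL] := nrm_bounded (opow T n).
pose w := nrm (A y - iter n T y).
have w0 : 0 < w.
  rewrite lt_neqAle nrm_ge0 andbT eq_sym.
  by apply/eqP => /nrm0_eq0/eqP; rewrite subr_eq0 => /eqP/hy.
have K0 : 0 < M + L + 1 by lra.
exists y, (Num.min (r / 2) (w / (M + L + 1))).
  by rewrite lt_min !divr_gt0.
split; first by have : Num.min (r / 2) (w / (M + L + 1)) <= r / 2;
  [rewrite ge_min lexx|lra].
move=> z; rewrite le_min => /andP[_]; rewrite ler_pdivlMr// => hz Az.
have : w <= (M + L) * nrm (z - y).
  rewrite mulrDl; have := hM (z - y); have := hL (z - y).
  have := nrmB (A (z - y)) (opow T n (z - y)).
  have -> : A (z - y) - opow T n (z - y) = - (A y - iter n T y).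
    by rewrite /= iter_opB linearB/= Az !opprB addrC addrA subrK.
  rewrite nrmN -/w; lra.
have := nrm_ge0 (z - y); nra.
Qed.

End OrbRef.

(** * Norm growth of subnormal operators *)

Section Paranormal.
Variables (R : realType).

Lemma normal_nrm_adj (K : hilbertType R) (N Nadj : {bounded_op K -> K}) :
  is_adjoint N Nadj -> (forall x, N (Nadj x) = Nadj (N x)) ->
  forall x, nrm (Nadj x) = nrm (N x).
Proof.
move=> adj comm x; have radj u v : rdot (N u) v = rdot u (Nadj v).
  by rewrite /rdot adj.
apply/eqP; rewrite -(eqrXn2 (ltn0Sn 1)) ?nrm_ge0//.
by rewrite -!rdotxx -radj comm rdotC radj.
Qed.

(** For a normal [N], [|N k|^2 = <N* N k, k>] and [|N* N k| = |N N k|]. *)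
Lemma subnormal_paranormal (H : hilbertType R) (T : {bounded_op H -> H}) :
  subnormal T -> forall x, nrm (T x) ^+ 2 <= nrm (T (T x)) * nrm x.
Proof.
move=> [K [J [N [Jiso [Nadj adj comm] NJ]]]] x.
have nrmJ y : nrm (J y) = nrm y.
  apply/eqP; rewrite -(eqrXn2 (ltn0Sn 1)) ?nrm_ge0//.
  by rewrite -!rdotxx /rdot Jiso.
rewrite -!nrmJ -!NJ -(normal_nrm_adj adj comm (N (J x))) -rdotxx.
have -> : rdot (N (J x)) (N (J x)) = rdot (Nadj (N (J x))) (J x).
  by rewrite [RHS]rdotC /rdot adj.
exact: le_trans (ler_norm _) (rdot_le _ _).
Qed.

(** By the inequality of arithmetic and geometric means the sequence
[|T^n x|] is convex, hence above its initial tangent. *)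
Lemma paranormal_nrm_iter_ge (H : hilbertType R) (T : {bounded_op H -> H}) :
  (forall x, nrm (T x) ^+ 2 <= nrm (T (T x)) * nrm x) ->
  forall x n, nrm x + n%:R * (nrm (T x) - nrm x) <= nrm (iter n T x).
Proof.
move=> para x n.
have convex y : nrm (T y) - nrm y <= nrm (T (T y)) - nrm (T y).
  have := para y; have := nrm_ge0 y; have := nrm_ge0 (T y).
  have := nrm_ge0 (T (T y)).
  move: (nrm y) (nrm (T y)) (nrm (T (T y))) => a b c c0 b0 a0 bca.
  have : 2 * b <= a + c; last by lra.
  rewrite -(ler_pXn2r (n:=2)) ?nnegrE ?mulr_ge0 ?addr_ge0//.
  have := sqr_ge0 (a - c); nra.
have step m : nrm (T x) - nrm x <= nrm (iter m.+1 T x) - nrm (iter m T x).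
  by elim: m => //= m IH; exact: le_trans IH (convex _).
elim: n => [|n IH]; first by rewrite mul0r addr0.
have := step n; rewrite -natr1 mulrDl mul1r; lra.
Qed.

Lemma paranormal_rec_contr (H : hilbertType R) (T A : {bounded_op H -> H}) x :
  (forall x, nrm (T x) ^+ 2 <= nrm (T (T x)) * nrm x) ->
  (forall N, exists2 n, (N <= n)%N & nrm (iter n T x - A x) < 1) ->
  nrm (T x) <= nrm x.
Proof.
move=> para rec; rewrite leNgt; apply/negP; rewrite -subr_gt0 => d0.
pose M := (nrm (A x) + 1) / (nrm (T x) - nrm x).
have [n Mn hn] := rec (Num.truncn M).+1.
have : M < n%:R.
  by apply: lt_le_trans (Num.Theory.truncnS_gt M) _; rewrite ler_nat.
rewrite /M ltr_pdivrMr//.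
have := paranormal_nrm_iter_ge para x n; have := nrm_ge0 x.
have := nrmD (iter n T x - A x) (A x); rewrite subrK; lra.
Qed.

End Paranormal.

(** * Closure in the strong operator topology *)

Section Topology.
Variables (R : realType) (H : hilbertType R) (T A : {bounded_op H -> H}).

Lemma closure_Orb_subset_OrbRef :
  closure (Orb T : set (sot H H)) A -> OrbRef T A.
Proof.
move=> cl x B /= nB.
pose ev : sot H H -> H := fun f => (f : {bounded_op H -> H}) x.
have evc : continuous ev.
  move=> f; apply: (@continuous_comp _ _ _
    (fun g : sot H H => (g : {bounded_op H -> H}) : {ptws H -> H})
    (fun g : {ptws H -> H} => g x)).
    exact: initial_continuous.
  exact: (@proj_continuous _ (fun=> H) x).
have [_ [[n _ <-] Bn]] := cl _ (evc A _ nB).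
by exists (opow T n x); split=> //; exists n.
Qed.

Lemma closure_Orb_of_approx :
  (forall (l : seq H) (e : R), 0 < e ->
     exists n, forall z, z \in l -> nrm (iter n T z - A z) < e) ->
  closure (Orb T : set (sot H H)) A.
Proof.
move=> approx.
(* The indices satisfying finitely many approximations generate a filter along
   which the powers of [T] converge to [A] pointwise. *)
pose near (p : seq H * R) : set nat :=
  [set n | forall z, z \in p.1 -> nrm (iter n T z - A z) < p.2].
pose F : set_system nat := filter_from [set p : seq H * R | 0 < p.2] near.
have FF : Filter F.
  apply: filter_from_filter; first by exists ([::], 1) => /=.
  move=> [l e] [l' e'] /= e0 e'0.
  exists (l ++ l', Num.min e e') => /=; first by rewrite lt_min e0.
  move=> n hn; split => z zl; apply: lt_le_trans (hn z _) _ => /=;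
    by rewrite ?mem_cat ?zl ?orbT// ge_min lexx ?orbT.
have FP : ProperFilter F.
  apply: filter_from_proper => -[l e] /= e0; have [n hn] := approx l e e0.
  by exists n.
pose ops n : {ptws H -> H} := iter n T.
have cvgF : ops @ F --> (A : {ptws H -> H}).
  apply/pointwise_cvgP => x; apply/cvgrPdist_lt => e e0.
  have eE : e = (complex.Re e)%:C%C by rewrite RRe_real// gtr0_real.
  exists ([:: x], complex.Re e); first by rewrite /= -ltcR -eE.
  move=> n /(_ x (mem_head _ _)).
  by rewrite /= eE nrmE ltcR nrmBC.
move=> B [_ [[C oC <-] CA CB]].
have nC : nbhs (A : {ptws H -> H}) C by exact: open_nbhs_nbhs.
have [n Cn] := @filter_ex _ F _ _ (cvgF _ nC).
by exists (opow T n); split; [exists n|exact: CB].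
Qed.

End Topology.

(** * Orbit reflexivity *)

Theorem theorem8 (R : realType) (H : hilbertType R) (T : {bounded_op H -> H})
  (T_subnormal : subnormal T) : orbit_reflexive T.
Proof.
apply/seteqP; split=> A; last exact: closure_Orb_subset_OrbRef.
move=> AT; apply: closure_Orb_of_approx.
have [[n An]|offT] := pselect (exists n, forall x, A x = iter n T x).
  by move=> l e e0; exists n => z _; rewrite An subrr nrm0.
have off n : exists v, A v <> iter n T v.
  apply/existsNP => An; apply: offT; by exists n.
have dense := dense_off_orbit off.
have rec x : (forall n, A x <> iter n T x) -> forall (e : R) N, 0 < e ->
    exists2 n, (N <= n)%N & nrm (iter n T x - A x) < e.
  by move=> hx; exact: off_orbit_rec.
have para := subnormal_paranormal T_subnormal.
have T_contr x : nrm (T x) <= nrm x.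
  have [M M0 hM] := nrm_bounded T; have M1 : 0 < M + 1 by lra.
  apply/ler_addgt0Pr => e e0.
  have [y yx hy] := dense x _ (divr_gt0 e0 M1).
  have Ty : nrm (T y) <= nrm y.
    by apply: (paranormal_rec_contr para) => N; exact: rec.
  rewrite ler_pdivlMr// in yx.
  have := nrmB (T y) (T (y - x)); have -> : T y - T (y - x) = T x.
    by rewrite linearB opprB addrC subrK.
  have := hM (y - x); have := nrmD (y - x) x; rewrite subrK; lra.
apply: contraction_sot_approx => // x e N e0.
have [M M0 hM] := nrm_bounded A; have M2 : 0 < M + 2 by lra.
have [y yx hy] := dense x _ (divr_gt0 (divr_gt0 e0 (ltr0n R 2)) M2).
have [n Nn hn] := rec y hy (e / 2) N (divr_gt0 e0 (ltr0n R 2)).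
exists n => //; rewrite ler_pdivlMr// in yx.
have -> : iter n T x - A x =
    (iter n T y - A y) - (iter n T (y - x) - A (y - x)).
  apply/eqP; rewrite iter_opB (linearB A) eq_sym subr_eq addrACA -opprD.
  by rewrite !subrKC.
have := nrmB (iter n T y - A y) (iter n T (y - x) - A (y - x)).
have := nrmB (iter n T (y - x)) (A (y - x)).
have := nrm_iter_le T_contr (y - x) (leq0n n); have := hM (y - x).
have := nrm_ge0 (y - x); rewrite /=; nra.
Qed.
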